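(* Let $(A_\alpha)_{\alpha<\lambda}$ be a sequence of graph-like $\varphi$-sets in structures $(\mathcal{M}_\alpha)_{\alpha<\lambda}$ with a common language, such that $\mathrm{isoSh}(A_\alpha)=\mathrm{isoSh}(A_\delta)$ for all $\alpha,\delta<\lambda$. Let $\Gamma$ be the collection of $\leq$-minimal isomorphism types of finite graphs not in $\mathrm{isoSh}(A_0)$, and for each $\mathbb{H}\in\Gamma$ let $B_{\mathbb{H}}$ be a necessary set for $\mathbb{H}$ in $\mathrm{isoSh}(A_0)$. Then every $\lambda$-type of $\widehat{\mathcal{M}}=\prod_{\alpha<\lambda}\mathcal{M}_\alpha/\mathcal{D}$ that is an $(A_\alpha)$-type is realized in $\widehat{\mathcal{M}}$ if and only if every graph-like function $f:\mathcal{P}_\omega(\lambda)\to\mathcal{D}$ satisfying \[\bigcap_{\{a,b\}\in E^{\mathbb{H}}}f(\{x(a),x(b)\})\subseteq\bigcup_{\{c,d\}\in B_{\mathbb{H}}}f(\{x(c),x(d)\})\] for all $\mathbb{H}\in\Gamma$ and all injective functions $x:H\to\lambda$ has a multiplicative refinement.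
   Context: $\lambda$ is an infinite cardinal and $\mathcal{D}$ a regular ultrafilter on $\lambda$; $\mathcal{P}_\omega(\lambda)$ the finite subsets of $\lambda$, $[X]^2$ the 2-element subsets. Fix a formula $\varphi(\bar{x};\bar{y})$, $|\bar y|=n$. A $\varphi$-set in a structure $\mathcal{M}$ is a nonempty $A\subseteq M^n$; it is graph-like if for every finite $B\subseteq A$ with $|B|\ge2$, $\{\varphi(\bar{x};\bar{a}):\bar{a}\in B\}$ is consistent iff $\{\varphi(\bar x;\bar a):\bar a\in C\}$ is consistent for every $C\in[B]^2$. $\mathrm{Sh}(A)$ is the set of pairs $(\mathbb{G},\theta)$ where $\mathbb{G}$ is a simple graph on $\{1,\dots,m\}$ for some $m\geq1$, $\theta:\{1,\dots,m\}\to A$, $\mathcal{M}\models\exists\bar{x}\,\varphi(\bar{x};\theta(i))$ for each $i$, and distinct $i,j$ are adjacent iff $\mathcal{M}\models\exists\bar{x}(\varphi(\bar{x};\theta(i))\wedge\varphi(\bar{x};\theta(j)))$. $\mathrm{isoSh}(A)$ is the set of isomorphism types of graphs $\mathbb{G}$ with $(\mathbb{G},\theta)\in\mathrm{Sh}(A)$. For graphs, $\mathbb{H}\le\mathbb{G}$ means there is an injective homomorphism $\mathbb{H}\to\mathbb{G}$ that also preserves non-edges. For a graph $\mathbb{H}$ and a set $S$ of graphs (isomorphism types) none of which has $\mathbb{H}$ as $\le$-subgraph, a set $B\subseteq[H]^2\setminus E^{\mathbb{H}}$ is necessary for $\mathbb{H}$ in $S$ if whenever $\mathbb{G}\in S$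 and $\psi:\mathbb{H}\to\mathbb{G}$ is an injective graph homomorphism, some $\{\psi(a),\psi(b)\}$ with $\{a,b\}\in B$ is an edge of $\mathbb{G}$. A $\varphi$-type $p(\bar{x})=\{\varphi(\bar{x},\bar{a}_\beta):\beta<\lambda\}$ of $\widehat{\mathcal{M}}$ is an $(A_\alpha)$-type if its parameters have representatives $\bar r_\beta\in\prod_\alpha M_\alpha^n$ with $\bar{r}_\beta(\alpha)\in A_\alpha$ for all $\alpha,\beta$. A function $f:\mathcal{P}_\omega(\lambda)\to\mathcal{D}$ is graph-like if $f(\Delta)=\bigcap_{\Phi\in[\Delta]^2}f(\Phi)$ whenever $|\Delta|\ge2$. A multiplicative refinement of $f$ is $g:\mathcal{P}_\omega(\lambda)\to\mathcal{D}$ with $g(\Delta)\subseteq f(\Delta)$ and $g(\Delta\cup\Phi)=g(\Delta)\cap g(\Phi)$ for all $\Delta,\Phi$. *)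

(* Defs.v *)
From HB Require Import structures.
From mathcomp Require Export all_boot finmap generic_quotient.
From mathcomp Require Export boolp classical_sets functions cardinality filter.

Set Implicit Arguments.
Unset Strict Implicit.
Unset Printing Implicit Defensive.

Local Open Scope classical_set_scope.
Local Open Scope card_scope.
Local Open Scope quotient_scope.

Record language := Language {
  funsym : Type;
  funar : funsym -> nat;
  relsym : Type;
  relar : relsym -> nat }.

Inductive term (S : language) (V : Type) : Type :=
| Var of V
| App (s : funsym S) of 'I_(funar s) -> term S V.

(* Formulas with free variables in [V]; [None] is the variable bound by [Ex].
   The remaining connectives and [forall] are classically definable. *)
Inductive formula (S : language) (V : Type) : Type :=
| Eq of term S V & term S V
| Rel (s : relsym S) of 'I_(relar s) -> term S V
| Neg of formula S V
| And of formula S V & formula S V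
| Ex of formula S (option V).

Record structure (S : language) := Structure {
  carrier :> Type;
  carrier_inh : inhabited carrier;
  funint : forall s : funsym S, ('I_(funar s) -> carrier) -> carrier;
  relint : forall s : relsym S, ('I_(relar s) -> carrier) -> Prop }.

Fixpoint eval (S : language) (M : structure S) (V : Type) (v : V -> M)
    (t : term S V) : M :=
  match t with
  | Var x => v x
  | App s ts => funint (fun i => eval v (ts i))
  end.

Fixpoint sat (S : language) (M : structure S) (V : Type) (p : formula S V) :
    (V -> M) -> Prop :=
  match p with
  | Eq t u => fun v => eval v t = eval v u
  | Rel s ts => fun v => relint (fun i => eval v (ts i))
  | Neg q => fun v => ~ sat q v
  | And q r => fun v => sat q v /\ sat r v
  | Ex q => fun v => exists c : M, sat q (fun o => if o is Some x then v x else c)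
  end.

(* A formula with its free variables partitioned into an m-tuple and an
   n-tuple. *)
Definition pformula (S : language) (m n : nat) := formula S ('I_m + 'I_n).

Definition power (M : Type) (n : nat) := 'I_n -> M.

Definition psat (S : language) (m n : nat) (phi : pformula S m n)
    (M : structure S) (x : power M m) (y : power M n) : Prop :=
  sat phi (fun i => match i with inl j => x j | inr j => y j end).

(* Consistency of {phi(x; a) : a in P}, i.e. finite satisfiability in M. *)
Definition consistent (S : language) (m n : nat) (phi : pformula S m n)
    (M : structure S) (P : set (power M n)) : Prop :=
  forall C : set (power M n), finite_set C -> C `<=` P ->
    exists x : power M m, forall a, C a -> psat phi x a.

Section Ultraproduct.
Variables (S : language) (L : Type) (D : set_system L) (M : L -> structure S).

Definition ueq (r s : forall i, M i) : Prop := D [set i | r i = s i].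

Definition ucarrier : Type :=
  {C : set (forall i, M i) | exists r, C = ueq r}.

Definition uclass (r : forall i, M i) : ucarrier :=
  exist _ (ueq r) (ex_intro _ r erefl).

Definition urepr (c : ucarrier) : forall i, M i := projT1 (cid (proj2_sig c)).

Lemma ucarrier_inh : inhabited ucarrier.
Proof.
have [r _] : exists r : forall i, M i, True.
  suff r : forall i, M i by exists r.
  move=> i; suff /cid[] : exists c : M i, True by [].
  by case: (carrier_inh (M i)) => c; exists c.
exact: inhabits (uclass r).
Qed.

(* When D is a filter the interpretations below do not depend on the
   representatives chosen by [urepr]. *)
Definition ultraproduct : structure S :=
  @Structure S ucarrier ucarrier_inh
    (fun s cs => uclass (fun i => funint (fun k => urepr (cs k) i)))
    (fun s cs => D [set i | relint (fun k => urepr (cs k) i)]).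

End Ultraproduct.

(* |L|-regularity: a family of |L| many members of D such that every point
   lies in finitely many of them. *)
Definition regular_system (L : Type) (D : set_system L) : Prop :=
  exists E : set (set L), [/\ E `<=` D, E #= [set: L] &
    forall i : L, finite_set [set X | E X /\ X i]].

Record fgraph := FGraph {
  order : nat;
  order_gt0 : (0 < order)%N;
  adj : rel 'I_order;
  adj_sym : symmetric adj;
  adj_irr : irreflexive adj }.

Definition vertex (G : fgraph) : finType := 'I_(order G).

HB.instance Definition _ := gen_eqMixin fgraph.
HB.instance Definition _ := gen_choiceMixin fgraph.

Definition pairs (V : finType) : {set {set V}} := [set e : {set V} | #|e| == 2]%SET.

Definition edges (G : fgraph) : {set {set (vertex G)}} :=
  [set [set p.1; p.2] | p : vertex G * vertex G & adj p.1 p.2]%SET.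

Definition fhom (H G : fgraph) (h : vertex H -> vertex G) : Prop :=
  forall a b, adj a b -> adj (h a) (h b).

Definition fembed (H G : fgraph) : Prop :=
  exists h : vertex H -> vertex G,
    [/\ injective h, fhom h & forall a b, ~~ adj a b -> ~~ adj (h a) (h b)].

Definition fiso (H G : fgraph) : bool :=
  `[< exists2 h : vertex H -> vertex G,
        bijective h & forall a b, adj (h a) (h b) = adj a b >].

Lemma fiso_refl : reflexive fiso.
Proof. by move=> G; apply/asboolP; exists id => //; exists id. Qed.

Lemma fiso_sym : symmetric fiso.
Proof.
suff half G H : fiso G H -> fiso H G by move=> G H; apply/idP/idP => /half.
move=> /asboolP[h [k hk kh] hE]; apply/asboolP; exists k; first by exists h.
by move=> a b; rewrite -hE !kh.
Qed.

Lemma fiso_trans : transitive fiso.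
Proof.
move=> G H K /asboolP[h hB hE] /asboolP[k kB kE]; apply/asboolP.
by exists (k \o h); [exact: bij_comp | move=> a b /=; rewrite kE hE].
Qed.

Canonical fiso_equiv := EquivRel fiso fiso_refl fiso_sym fiso_trans.

(* Isomorphism types of nonempty finite graphs; [repr T] is a graph of
   type T. *)
Definition isotype := {eq_quot fiso_equiv}.
HB.instance Definition _ := Choice.on isotype.
HB.instance Definition _ := EqQuotient.on isotype.

Definition isotype_of (G : fgraph) : isotype := \pi_isotype G.

Definition isotype_le (H G : isotype) : Prop := fembed (repr H) (repr G).

Definition minimal_excluded (S : set isotype) : set isotype :=
  [set H | ~ S H /\ forall K, ~ S K -> isotype_le K H -> K = H].

(* The first clause is the condition on H and S under which the notion is
   defined. *)
Definition necessary (H : fgraph) (S : set isotype)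
    (B : {set {set (vertex H)}}) : Prop :=
  [/\ forall G, S G -> ~ fembed H (repr G),
      B \subset pairs (vertex H) :\: edges H &
      forall G, S G -> forall psi : vertex H -> vertex (repr G),
        injective psi -> fhom psi ->
        exists2 e, e \in B & (psi @: e)%SET \in edges (repr G)].

Section PhiSets.
Variables (S : language) (m n : nat) (phi : pformula S m n).

Definition phi_set (M : structure S) (A : set (power M n)) : Prop := A !=set0.

Definition graph_like_set (M : structure S) (A : set (power M n)) : Prop :=
  forall B : set (power M n), finite_set B -> B `<=` A -> `I_2 #<= B ->
    (consistent phi B <->
     forall C : set (power M n), C `<=` B -> C #= `I_2 -> consistent phi C).

Definition Sh (M : structure S) (A : set (power M n)) (G : fgraph)
    (theta : vertex G -> power M n) : Prop :=
  [/\ forall i, A (theta i),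
      forall i, exists x : power M m, psat phi x (theta i) &
      forall i j, i <> j ->
        (adj i j <-> exists x : power M m,
                       psat phi x (theta i) /\ psat phi x (theta j))].

Definition isoSh (M : structure S) (A : set (power M n)) : set isotype :=
  [set T | exists G theta, Sh A (G := G) theta /\ T = isotype_of G].

Variables (L : choiceType) (D : set_system L) (M : L -> structure S).

(* [a b] is the parameter of the b-th formula of the type. *)
Definition is_type (a : L -> power (ultraproduct D M) n) : Prop :=
  consistent phi (range a).

Definition realized (a : L -> power (ultraproduct D M) n) : Prop :=
  exists x : power (ultraproduct D M) m, forall b, psat phi x (a b).

Definition has_representatives_in (A : forall i, set (power (M i) n))
    (a : L -> power (ultraproduct D M) n) : Prop :=
  exists r : L -> forall i, power (M i) n,
    (forall b i, A i (r b i)) /\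
    (forall b, a b = fun k => uclass D (fun i => r b i k)).

End PhiSets.

Section FinsetFunctions.
Variables (L : choiceType) (D : set_system L).

Definition maps_into (f : {fset L} -> set L) : Prop := forall d, D (f d).

Definition graph_like_fun (f : {fset L} -> set L) : Prop :=
  forall d : {fset L}, (2 <= #|` d|)%N ->
    f d = \bigcap_(e in [set e : {fset L} | (e `<=` d)%fset /\ #|` e| = 2]) f e.

Definition multiplicative_refinement (f g : {fset L} -> set L) : Prop :=
  [/\ maps_into g, forall d, g d `<=` f d &
      forall d e, g (d `|` e)%fset = g d `&` g e].

Definition respects (H : fgraph) (B : {set {set (vertex H)}})
    (f : {fset L} -> set L) : Prop :=
  forall x : vertex H -> L, injective x ->
    \bigcap_(e in [set` edges H]) f [fset x a | a in e]%fset `<=`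
    \bigcup_(e in [set` B]) f [fset x a | a in e]%fset.

End FinsetFunctions.

(* Main.v *)
Require Import Defs.
Set Implicit Arguments.
Unset Strict Implicit.
Unset Printing Implicit Defensive.

(** Regularity of [D] provides sets [X b] in [D] such that every [i] lies in
    finitely many of them.

    From refinements to realizations: for a type with representatives [r], let
    [f d] be the set of [i] at which [{phi(x; r b i) : b in d}] is satisfiable.
    By Los's theorem [f] maps into [D]; it is graph-like because the [A i] are,
    and it satisfies the conditions on [H] and [B H] because the graph of
    compatible pairs of any finite family in [A i] lies in [isoSh (A i)].  If
    [g] refines [f] multiplicatively, the [b] with [i] in [X b] and in
    [g {b}] are finitely many and simultaneously satisfiable at [i]; choosing
    a solution for every [i] realizes the type.

    From realizations to refinements: at [i], join [b] and [c] when [i] lies in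
    [f {b, c}].  On the finite set of [b] with [i] in [X b] this graph lies in
    [isoSh (A i)]: otherwise it contains a minimal excluded [H] as an induced
    subgraph, and the condition on [f] makes some pair of [B H], a non-edge of
    [H], an edge.  A copy of this graph in [A i] for every [i] yields a
    type, and if [x] realizes it then [d] is sent by the refinement to the
    indices where [x] satisfies the formulas with index in [d]. *)

Local Open Scope classical_set_scope.
Local Open Scope card_scope.
Local Open Scope quotient_scope.

Lemma dependent_choice_ex (I : Type) (T : I -> Type) (P : forall i, T i -> Prop) :
  (forall i, exists x, P i x) -> exists f : forall i, T i, forall i, P i (f i).
Proof.
by move=> H; exists (fun i => projT1 (cid (H i))) => i; case: cid.
Qed.

(** * Los's theorem for the ultraproduct *)

Section Los.
Variables (S : language) (L : Type) (D : set_system L) (M : L -> structure S).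
Hypothesis ultraD : UltraFilter D.
Let properD : ProperFilter D := ultra_proper.

Lemma uclass_eq (r s : forall i, M i) :
  uclass D r = uclass D s <-> D [set i | r i = s i].
Proof.
split=> [rs|rs].
  have: ueq D r r by rewrite /ueq; apply: filterE.
  have -> : ueq D r = ueq D s by exact: (congr1 (@proj1_sig _ _) rs).
  by rewrite /ueq; apply: filterS => i /= ->.
suff e : ueq D r = ueq D s by apply: eq_exist; rewrite e.
apply/seteqP; split=> t; rewrite /ueq; apply: filterS2 rs => i /=; congruence.
Qed.

Lemma ureprK (c : ultraproduct D M) : uclass D (urepr c) = c.
Proof.
by case: c => C hC; apply: eq_exist; rewrite /urepr; case: cid => r /= ->.
Qed.

Lemma eval_ultraproduct (V : Type) (w : V -> forall i, M i) (t : term S V) :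
  eval (M := ultraproduct D M) (fun x => uclass D (w x)) t =
  uclass D (fun i => eval (fun x => w x i) t).
Proof.
elim: t => //= s ts IH; apply/uclass_eq.
(* Arities are finite, so the equalities for the single arguments hold together on one set of
   [D]. *)
have : \forall i \near D, forall k,
    urepr (eval (M := ultraproduct D M) (fun x => uclass D (w x)) (ts k)) i =
    eval (fun x => w x i) (ts k).
  by apply: filter_forall => k; apply/uclass_eq; rewrite ureprK IH.
by apply: filterS => i /= H; congr funint; apply/funext => k.
Qed.

Theorem los (V : Type) (p : formula S V) (w : V -> forall i, M i) :
  sat (M := ultraproduct D M) p (fun x => uclass D (w x)) <->
  D [set i | sat p (fun x => w x i)].
Proof.
elim: p w => {V} /=.
- by move=> V t u w; rewrite !eval_ultraproduct; exact: uclass_eq.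
- move=> V s ts w.
  have E : \forall i \near D, forall k,
    urepr (eval (M := ultraproduct D M) (fun x => uclass D (w x)) (ts k)) i =
    eval (fun x => w x i) (ts k).
    apply: filter_forall => k; apply/uclass_eq.
    by rewrite ureprK eval_ultraproduct.
  split; apply: filterS2 E => i /= E;
    by congr relint; apply/funext => k; rewrite E.
- move=> V q IH w; rewrite IH; split=> [nq|nq q'].
    by case: (in_ultra_setVsetC [set i | sat q (fun x => w x i)] ultraD).
  have /filter_ex[i []] // :
    D ([set i | ~ sat q (w^~ i)] `&` [set i | sat q (w^~ i)]).
  exact: filterI.
- move=> V q IHq r IHr w; rewrite IHq IHr; split=> [[q' r']|qr].
    exact: filterI.
  by split; apply: filterS qr => i [].
- move=> V q IH w; split=> [[c qc]|qw].
    pose w' (o : option V) := if o is Some x then w x else urepr c.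
    have /IH : sat (M := ultraproduct D M) q (fun o => uclass D (w' o)).
      rewrite -(ureprK c) in qc; move: qc; congr (sat _ _).
      by apply/funext => -[].
    apply: filterS => i /= H; exists (urepr c i); move: H; congr (sat _ _).
    by apply/funext => -[].
  pose good i c := sat (M := M i) q (fun o => if o is Some x then w x i else c).
  (* An arbitrary value where no witness exists makes [c] an element of the full product. *)
  have /dependent_choice_ex[c cP] : forall i, exists c, (exists c', good i c') -> good i c.
    move=> i; have [[c gc]|ng] := pselect (exists c', good i c').
      by exists c.
    by case: (carrier_inh (M i)) => c; exists c => /ng.
  exists (uclass D c).
  pose w' (o : option V) := if o is Some x then w x else c.
  have : sat (M := ultraproduct D M) q (fun o => uclass D (w' o)).
    apply/IH; apply: filterS qw => i /= /cP H; move: H; congr (sat _ _).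
    by apply/funext => -[].
  by congr (sat _ _); apply/funext => -[].
Qed.

Lemma psat_ultraproduct (m n : nat) (phi : pformula S m n)
    (x : 'I_m -> forall i, M i) (y : 'I_n -> forall i, M i) :
  psat phi (M := ultraproduct D M) (fun k => uclass D (x k))
    (fun k => uclass D (y k)) <->
  D [set i | psat phi (M := M i) (fun k => x k i) (fun k => y k i)].
Proof.
pose w j := match j with inl k => x k | inr k => y k end.
rewrite /psat; have := los phi w; rewrite /w.
have -> : (fun j => uclass D (match j with inl k => x k | inr k => y k end)) =
  (fun j => match j with inl k => uclass D (x k) | inr k => uclass D (y k) end).
  by apply/funext => -[].
move=> ->; split; apply: filterS => i /= H; move: H; congr (sat _ _);
  by apply/funext => -[].
Qed.

End Los.

(** * Embeddings and isomorphism types of finite graphs *)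

Lemma isotype_of_eq (G H : fgraph) : isotype_of G = isotype_of H <-> fiso G H.
Proof. by rewrite /isotype_of; split=> [/eqmodP|/eqmodP]. Qed.

Lemma fiso_repr (G : fgraph) : fiso G (repr (isotype_of G)).
Proof. by apply/isotype_of_eq; rewrite /isotype_of reprK. Qed.

Lemma fiso_fembed (G H : fgraph) : fiso G H -> fembed G H.
Proof.
move=> /asboolP[h /bij_inj hI hE]; by exists h; split=> // a b; rewrite hE.
Qed.

Lemma fembed_trans (H G K : fgraph) : fembed H G -> fembed G K -> fembed H K.
Proof.
move=> [h [hI hh hn]] [k [kI kh kn]]; exists (k \o h); split=> /=.
- exact: inj_comp.
- by move=> a b /hh/kh.
- by move=> a b /hn/kn.
Qed.

Lemma fembed_order_fiso (H G : fgraph) :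
  fembed H G -> (order G <= order H)%N -> fiso H G.
Proof.
move=> [h [hI hh hn]] GH; apply/asboolP; exists h.
  by apply: inj_card_bij => //; rewrite !card_ord.
move=> a b; case: (boolP (adj a b)) => [/hh //|/hn/negbTE //].
Qed.

(** Descent on the number of vertices: by [fembed_order_fiso], a graph of another type that embeds
    in [T] has strictly fewer vertices. *)
Lemma minimal_excluded_le (S : set isotype) (T : isotype) :
  ~ S T -> exists2 H, minimal_excluded S H & isotype_le H T.
Proof.
have [k] := ubnP (order (repr T)); elim: k T => // k IH T Tk nST.
have [mT|] := pselect (minimal_excluded S T).
  by exists T => //; apply: fiso_fembed; exact: fiso_refl.
move=> /not_andP[//|/existsNP[K /not_implyP[nSK /not_implyP[KT nKT]]]].
have KltT : (order (repr K) < order (repr T))%N.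
  rewrite ltnNge; apply/negP => TK; apply: nKT.
  by have /isotype_of_eq := fembed_order_fiso KT TK; rewrite /isotype_of !reprK.
have [|H mH HK] := IH K _ nSK; first exact: leq_trans KltT Tk.
by exists H => //; exact: fembed_trans HK KT.
Qed.

Lemma adj_mem_edges (G : fgraph) (a b : vertex G) :
  ([set a; b]%SET \in edges G) = adj a b.
Proof.
apply/imsetP/idP => [[[c d]]|ab]; last by exists (a, b); rewrite ?inE.
rewrite inE /= => cd /setP E.
have ncd : c != d by apply: contraTneq cd => ->; rewrite adj_irr.
have := E c; have := E d; have := E a; have := E b.
rewrite !inE !eqxx /= !orbT => /esym/orP[]/eqP-> /esym/orP[]/eqP->;
  rewrite ?orbb ?(negbTE ncd) ?(eq_sym d) ?(negbTE ncd) // => _ _;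
  by rewrite adj_sym.
Qed.

Lemma edgesP (G : fgraph) (e : {set vertex G}) :
  e \in edges G -> exists a b, adj a b /\ e = [set a; b]%SET.
Proof. by move=> /imsetP[[a b]]; rewrite inE /= => ab ->; exists a, b. Qed.

Section InducedGraph.
Variables (k : nat) (k_gt0 : (0 < k)%N) (T : Type) (P : T -> T -> Prop).
Hypothesis P_sym : forall x y, P x y -> P y x.
Variable t : 'I_k -> T.

(** The diagonal is removed because [P] may hold there, as [compatible] does at satisfiable
    parameters. [t] may repeat values, so one parameter can label several vertices. *)
Let radj : rel 'I_k := fun a b => (a != b) && `[< P (t a) (t b) >].

Let radj_sym : symmetric radj.
Proof.
move=> a b; rewrite /radj eq_sym; congr andb.
by apply: asbool_equiv_eq; split; apply: P_sym.
Qed.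

Let radj_irr : irreflexive radj.
Proof. by move=> a; rewrite /radj eqxx. Qed.

Definition induced_graph : fgraph := FGraph k_gt0 radj_sym radj_irr.

Lemma induced_adjP (a b : vertex induced_graph) :
  reflect (a <> b /\ P (t a) (t b)) (adj a b).
Proof.
apply: (iffP andP) => [[/eqP ab /asboolP]|[/eqP ab /asboolP]] //.
Qed.

End InducedGraph.

(** * Graphs of compatible parameters in one structure *)

Section Shapes.
Variables (S : language) (m n : nat) (phi : pformula S m n) (M : structure S).
Implicit Types A : set (power M n).

(** On the diagonal this is satisfiability of a single formula, so one relation covers the vertex
    and the edge clauses of [Sh]. *)
Definition compatible (y z : power M n) : Prop :=
  exists x : power M m, psat phi x y /\ psat phi x z.

Lemma compatible_sym (y z : power M n) : compatible y z -> compatible z y.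
Proof. by move=> [x [xy xz]]; exists x. Qed.

Lemma isoSh_Sh A (G : fgraph) :
  isoSh phi A (isotype_of G) -> exists theta, Sh phi A (G := G) theta.
Proof.
move=> [H [theta [[thA th1 th2] /isotype_of_eq /asboolP[h hB hE]]]].
exists (theta \o h); split=> [i|i|i j ij] /=; [exact: thA|exact: th1|].
rewrite -hE; apply: th2 => /(bij_inj hB); exact: ij.
Qed.

(** The one-vertex graph detects a satisfiable parameter, whose existence therefore transfers
    between sets with the same [isoSh]. *)
Lemma isoSh_neq0 A : (exists y, A y /\ compatible y y) <-> isoSh phi A !=set0.
Proof.
split=> [[y [Ay [x [xy _]]]]|[T [G [theta [[thA th1 _] _]]]]]; last first.
  pose v : vertex G := Ordinal (order_gt0 G).
  by exists (theta v); split=> //; have [x] := th1 v; exists x.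
pose K := @induced_graph 1 isT unit (fun _ _ => True) (fun _ _ _ => I)
  (fun=> tt).
exists (isotype_of K), K, (fun=> y); split=> //; split=> // [i|i j].
  by exists x.
by case; rewrite !ord1.
Qed.

(** The compatibility graph on the vertices of [H] lies in [isoSh phi A] and contains every edge of
    [H], so the identity on vertices is an injective homomorphism to which necessity applies. *)
Lemma necessary_compatible A (H : fgraph) (B : {set {set vertex H}})
    (theta : vertex H -> power M n) :
  necessary (isoSh phi A) B ->
  (forall a, A (theta a)) -> (forall a, compatible (theta a) (theta a)) ->
  (forall a b, adj a b -> compatible (theta a) (theta b)) ->
  exists a b, [set a; b]%SET \in B /\ compatible (theta a) (theta b).
Proof.
move=> [_ Bsub Bnec] thA thc thadj.
pose G := induced_graph (order_gt0 H) compatible_sym theta.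
have SG : isoSh phi A (isotype_of G).
  exists G, theta; split=> //; split=> // [i|i j ij].
    by have [x [xi _]] := thc i; exists x.
  by split=> [/induced_adjP[]|c] //; apply/induced_adjP.
(* [necessary] quantifies over representatives of types, so the identity is composed with an
   isomorphism onto the representative. *)
have /asboolP[h hB hE] := fiso_repr G.
have [||e eB eG] := Bnec _ SG (h : vertex H -> _).
- exact: bij_inj.
- move=> a b ab; rewrite hE; apply/induced_adjP; split; last exact: thadj.
  by move=> E; move: ab; rewrite E adj_irr.
have := fintype.subsetP Bsub _ eB; rewrite !inE => /andP[_ /cards2P[a [b [ab E]]]].
rewrite {}E in eB eG; exists a, b; split=> //.
by move: eG; rewrite imsetU !imset_set1 adj_mem_edges hE => /induced_adjP[].
Qed.

(** A pair of [B H] is a non-edge of [H]; an embedding of [H] keeps it a non-edge, while the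
    hypothesis on [P] makes it an edge. *)
Lemma isoSh_induced A (B : forall H : isotype, {set {set vertex (repr H)}})
    (k : nat) (k_gt0 : (0 < k)%N) (T : Type) (P : T -> T -> Prop)
    (P_sym : forall x y, P x y -> P y x) (t : 'I_k -> T) :
  injective t ->
  (forall H, minimal_excluded (isoSh phi A) H -> necessary (isoSh phi A) (B H)) ->
  (forall H, minimal_excluded (isoSh phi A) H ->
    forall x : vertex (repr H) -> T, injective x ->
    (forall a b, adj a b -> P (x a) (x b)) ->
    exists a b, [set a; b]%SET \in B H /\ P (x a) (x b)) ->
  isoSh phi A (isotype_of (induced_graph k_gt0 P_sym t)).
Proof.
set G := induced_graph _ _ _ => tI Bnec PB.
apply: contrapT => /minimal_excluded_le[H mH HG].
have GG : fiso (repr (isotype_of G)) G by rewrite fiso_sym fiso_repr.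
have [h [hI hh hn]] := fembed_trans HG (fiso_fembed GG).
have [_ Bsub _] := Bnec H mH.
have [||a [b [abB Pab]]] := PB H mH (t \o h).
- exact: inj_comp.
- by move=> a b /hh/induced_adjP[].
have := fintype.subsetP Bsub _ abB; rewrite !inE adj_mem_edges => /andP[/hn/negP nab ab2].
apply: nab; apply/induced_adjP; split=> // /hI E.
by move: ab2; rewrite E finset.setUid cards1.
Qed.

(** [graph_like_set] concerns sets of at least two parameters, whereas [r] may repeat values. An
    empty [d] and a family constant on [d] are therefore treated apart. *)
Lemma graph_like_satisfiable A (T : choiceType) (r : T -> power M n)
    (d : {fset T}) :
  graph_like_set phi A -> (forall b, b \in d -> A (r b)) ->
  {in d &, forall b c, compatible (r b) (r c)} ->
  exists x : power M m, forall b, b \in d -> psat phi x (r b).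
Proof.
move=> glA rA rc.
have [->|[b0 b0d]] := fset_0Vmem d.
  have [x0] := carrier_inh M; by exists (fun=> x0).
have [rE|] := pselect (forall c, c \in d -> r c = r b0).
  have [x [xb _]] := rc b0 b0 b0d b0d.
  by exists x => c cd; rewrite rE.
move=> /existsNP[c0 /not_implyP[c0d rb0c0]].
pose Bs := r @` [set` d].
have finB : finite_set Bs by apply: finite_image; exact: finite_fset.
have BsA : Bs `<=` A by move=> _ [b bd <-]; exact: rA.
have B2 : `I_2 #<= Bs.
  pose u (k : nat) := if k is 0 then r b0 else r c0.
  have uI : {in `I_2 &, injective u}.
    by move=> [|[|k]] [|[|l]]; rewrite !inE //= => _ _ /esym // /esym.
  rewrite -(card_le_eql (inj_card_eq uI)); apply: subset_card_le.
  by move=> _ [[|k] _ <-] /=; [exists b0|exists c0].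
have [_ cons] := glA Bs finB BsA B2.
have [|x xP] := cons _ Bs finB (@subset_refl _ _); last first.
  by exists x => b bd; apply: xP; exists b.
(* The bijection [u] shows that [C] consists of [y0] and [y1]; a common solution for two indices
   with these values solves every part of it. *)
move=> C CB /card_set_bijP[u [uf uI us]] C' _ C'C.
have [y0 Cy0 y00] := us 0%N isT; have [y1 Cy1 y11] := us 1%N isT.
have [b bd rb] := CB _ Cy0; have [c cd rc'] := CB _ Cy1.
have [x [xb xc]] := rc b c bd cd.
exists x => z /C'C Cz; have := uf _ Cz.
case uz : (u z) => [|[|k]] //= _.
- have -> : z = y0 by apply: uI; rewrite ?inE // uz.
  by rewrite -rb.
- have -> : z = y1 by apply: uI; rewrite ?inE // uz.
  by rewrite -rc'.
Qed.

End Shapes.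

(** * Functions on finite subsets, and regularity *)

Section FinsetFunctionLemmas.
Variable L : choiceType.

Lemma cardfs2P (e : {fset L}) :
  #|` e| = 2 -> exists b c, b != c /\ e = [fset b; c]%fset.
Proof.
move=> e2; have [b be] : exists b, b \in e.
  by apply/fset0Pn; rewrite -cardfs_gt0 e2.
move: e2; rewrite (cardfsD1 b) be add1n => -[] /eqP/cardfs1P[c ec].
have : c \in (e `\ b)%fset by rewrite ec inE.
rewrite !inE => /andP[cb ce]; exists b, c; split; first by rewrite eq_sym.
by rewrite -(fsetD1K be) ec.
Qed.

Lemma graph_like_funP (f : {fset L} -> set L) (d : {fset L}) (i : L) :
  graph_like_fun f -> (2 <= #|` d|)%N ->
  f d i <-> {in d &, forall b c, b != c -> f [fset b; c]%fset i}.
Proof.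
move=> fgl d2; rewrite (fgl d d2); split=> [fd b c bd cd bc|fd e [ed e2]].
  apply: fd; split; last by rewrite cardfs2 bc.
  by apply/fsubsetP => x /fset2P[]->.
have [b [c [bc E]]] := cardfs2P e2; rewrite E; move/fsubsetP: ed => ed.
by apply: fd => //; apply: ed; rewrite E ?fset21 ?fset22.
Qed.

Lemma imfset_set2 (V : finType) (x : V -> L) (a b : V) :
  [fset x c | c in [set a; b]%SET]%fset = [fset x a; x b]%fset.
Proof.
apply/fsetP => y; apply/imfsetP/fset2P => [[c /=]|[]->].
- by rewrite !inE => /orP[]/eqP-> ->; [left|right].
- by exists a => //=; rewrite !inE eqxx.
- by exists b => //=; rewrite !inE eqxx orbT.
Qed.

(** The enumeration of the regular family by [L] is injective, so finitely many sets through [i]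
    means finitely many indices. *)
Lemma regular_family (D : set_system L) : regular_system D ->
  exists X : L -> set L, (forall b, D (X b)) /\
    forall i, finite_set [set b | X b i].
Proof.
move=> [E [ED EL Efin]]; rewrite card_eq_sym in EL.
have /card_set_bijP[X [Xf XI _]] := EL.
exists X; split=> [b|i]; first by apply: ED; exact: Xf.
have XI' : {in [set b | X b i] &, injective X}.
  by move=> b c _ _; apply: XI; rewrite inE.
rewrite -(eq_finite_set (inj_card_eq XI')).
apply: sub_finite_set (Efin i) => _ [b Xbi <-]; split=> //; exact: Xf.
Qed.

End FinsetFunctionLemmas.

Lemma power_inh (S : language) (M : structure S) (m : nat) :
  exists x : power M m, True.
Proof. by case: (carrier_inh M) => c; exists (fun=> c). Qed.

(** * Types of the ultraproduct through representatives *)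

Section Types.
Variables (S : language) (L : choiceType) (D : set_system L).
Variables (M : L -> structure S) (m n : nat) (phi : pformula S m n).
Hypothesis ultraD : UltraFilter D.
Let properD : ProperFilter D := ultra_proper.
Variable r : L -> forall i, power (M i) n.

Let a (b : L) : power (ultraproduct D M) n := fun k => uclass D (r b ^~ k).

Lemma realized_uclass (x : forall i, power (M i) m) (b : L) :
  psat phi (M := ultraproduct D M) (fun k => uclass D (x ^~ k)) (a b) <->
  D [set i | psat phi (x i) (r b i)].
Proof. exact: (psat_ultraproduct ultraD phi (fun k => x ^~ k)). Qed.

Lemma power_uclass (x : power (ultraproduct D M) m) :
  exists y : forall i, power (M i) m, x = fun k => uclass D (y ^~ k).
Proof.
exists (fun i k => urepr (x k) i); apply/funext => k.
by rewrite -[LHS](ureprK (x k)).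
Qed.

(** The right-hand side says that the function of finite index sets attached to the type maps into
    [D]. Los's theorem carries solutions up and down. *)
Lemma is_type_uclass : is_type phi a <->
  forall d : {fset L},
    D [set i | exists x : power (M i) m, forall b, b \in d -> psat phi x (r b i)].
Proof.
split=> [ta d|rd C Cfin Ca].
  have [|_ [b _ <-]|x xP] := ta (a @` [set` d]).
  - by apply: finite_image; exact: finite_fset.
  - by exists b.
  have [y xy] := power_uclass x.
  have : D (\bigcap_(b in [set` d]) [set i | psat phi (y i) (r b i)]).
    apply: filter_bigI => b bd; apply/realized_uclass.
    by rewrite -xy; apply: xP; exists b.
  by apply: filterS => i H; exists (y i) => b bd; exact: H.
have [C0|/set0P[c0 Cc0]] := eqVneq C set0.
  by have [x _] := power_inh (ultraproduct D M) m; exists x => c; rewrite C0.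
have [b0 _ _] := Ca _ Cc0.
(* One index per parameter reduces [C] to a finite index set; [b0] is the default outside [C]. *)
have /choice[s sP] : forall c, exists b, C c -> a b = c.
  move=> c; have [/Ca[b _ <-]|nC] := pselect (C c); first by exists b.
  by exists b0.
have /finite_fsetP[d dE] : finite_set (s @` C) by exact: finite_image.
have /dependent_choice_ex[x xP] : forall i, exists x : power (M i) m,
    (exists x' : power (M i) m, forall b, b \in d -> psat phi x' (r b i)) ->
    forall b, b \in d -> psat phi x (r b i).
  move=> i; have [[x xP]|nx] := pselect (exists x' : power (M i) m,
    forall b, b \in d -> psat phi x' (r b i)); first by exists x.
  by have [x _] := power_inh (M i) m; exists x => /nx.
exists (fun k => uclass D (x ^~ k)) => c Cc; rewrite -(sP c Cc).
apply/realized_uclass; apply: filterS (rd d) => i /xP; apply.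
by have : (s @` C) (s c) by [exists c]; rewrite dE.
Qed.

End Types.

(** * The two implications *)

Lemma multiplicative_fset1 (L : choiceType) (D : set_system L)
    (f g : {fset L} -> set L) (d : {fset L}) (i : L) :
  multiplicative_refinement D f g -> d != fset0 ->
  (forall b, b \in d -> g [fset b]%fset i) -> g d i.
Proof.
move=> [_ _ gU].
have [k] := ubnP #|` d|; elim: k d => // k IH d dk /fset0Pn[b bd] gd.
have E := fsetD1K bd.
(* The induction stops at singletons: for the empty set the hypothesis is vacuous, and [g fset0]
   need not contain [i]. *)
have [e0|eN] := eqVneq (d `\ b)%fset fset0.
  by rewrite -E e0 fsetU0; exact: gd.
rewrite -E gU; split; first exact: gd.
apply: IH => // [|c]; last by rewrite !inE => /andP[_ /gd].
by move: dk; rewrite (cardfsD1 b) bd.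
Qed.

Section Realization.
Variables (L : choiceType) (D : set_system L).
Hypotheses (ultraD : UltraFilter D) (regD : regular_system D).
Variables (S : language) (m n : nat) (phi : pformula S m n).
Variables (M : L -> structure S) (A : forall i : L, set (power (M i) n)).
Arguments A : clear implicits.
Hypothesis A_graph_like : forall i, graph_like_set phi (A i).
Hypothesis A_isoSh : forall i j, isoSh phi (A i) = isoSh phi (A j).
Variables (i0 : L) (B : forall H : isotype, {set {set (vertex (repr H))}}).
Hypothesis B_necessary : forall H, minimal_excluded (isoSh phi (A i0)) H ->
  necessary (isoSh phi (A i0)) (B H).
Let properD : ProperFilter D := ultra_proper.

(* An isolated vertex of [H] imposes nothing on [f], whereas [Sh] wants each
   [phi(x; theta i)] satisfiable; so representatives are first changed, off a
   set in [D], to be individually satisfiable everywhere. *)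
Lemma satisfiable_representatives (a : L -> power (ultraproduct D M) n) :
  is_type phi a -> has_representatives_in A a ->
  exists r : L -> forall i, power (M i) n,
    [/\ forall b i, A i (r b i),
        forall b i, compatible phi (r b i) (r b i) &
        a = fun b k => uclass D (r b ^~ k)].
Proof.
move=> ta [r0 [r0A /funext aE]]; subst a.
have t0 := (is_type_uclass phi ultraD r0).1 ta.
(* The type provides a satisfiable parameter at some [j]; equality of the [isoSh] moves its
   existence to every [i]. *)
have /dependent_choice_ex[y yP] i : exists y, A i y /\ compatible phi y y.
  apply/isoSh_neq0; have /filter_ex[j [x xP]] := t0 [fset i0]%fset.
  rewrite (A_isoSh i j); apply/isoSh_neq0; exists (r0 i0 j); split=> //.
  by exists x; split; apply: xP; rewrite inE.
pose r b i := if `[< compatible phi (r0 b i) (r0 b i) >] then r0 b i else y i.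
have rP b i : A i (r b i) /\ compatible phi (r b i) (r b i).
  by rewrite /r; case: asboolP.
exists r; split=> [b i|b i|]; try by have [] := rP b i.
apply/funext => b; apply/funext => k; apply/uclass_eq => //.
apply: filterS (t0 [fset b]%fset) => i [x xP] /=; rewrite /r.
by case: asboolP => // -[]; exists x; split; apply: xP; rewrite inE.
Qed.

Lemma realized_of_refinements :
  (forall f : {fset L} -> set L,
     maps_into D f -> graph_like_fun f ->
     (forall H, minimal_excluded (isoSh phi (A i0)) H -> respects (B H) f) ->
     exists g : {fset L} -> set L, multiplicative_refinement D f g) ->
  forall a : L -> power (ultraproduct D M) n,
    is_type phi a -> has_representatives_in A a -> realized phi a.
Proof.
move=> ref a ta ra; have [r [rA rc aE]] := satisfiable_representatives ta ra.
subst a => {ra}.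
pose f (d : {fset L}) := [set i | exists x : power (M i) m,
  forall b, b \in d -> psat phi x (r b i)].
have fD : maps_into D f := (is_type_uclass phi ultraD r).1 ta.
have f2 b c i : f [fset b; c]%fset i <-> compatible phi (r b i) (r c i).
  split=> [[x xP]|[x [xb xc]]]; exists x.
    by split; apply: xP; rewrite ?fset21 ?fset22.
  by move=> z /fset2P[]->.
have fgl : graph_like_fun f.
  move=> d d2; apply/seteqP; split=> [i [x xP] e [/fsubsetP ed _]|i fe].
    by exists x => b /ed/xP.
  apply: (graph_like_satisfiable (r := r^~ i) (@A_graph_like i)) => // b c bd cd.
  (* Pairs say nothing about equal indices, where the satisfiability built into [r] takes over. *)
  have [->|bc] := eqVneq b c; first exact: rc.
  apply/f2; apply: fe; split; last by rewrite cardfs2 bc.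
  by apply/fsubsetP => z /fset2P[]->.
have [|g gref] := ref f fD fgl.
  move=> H mH x _ i fE.
  have nec := B_necessary mH; rewrite (A_isoSh i0 i) in nec.
  (* Label the vertices of [H] through [x]: by [fE] the edges of [H] become compatible at [i], and
     necessity gives a compatible pair of [B H]. *)
  have [||| v [w [vwB vw]]] :=
    necessary_compatible (theta := fun v => r (x v) i) nec.
  - by [].
  - by [].
  - move=> v w vw; apply/f2; rewrite -imfset_set2; apply: fE.
    by rewrite /= adj_mem_edges.
  by exists [set v; w]%SET => //; rewrite imfset_set2; apply/f2.
have [gD gf gU] := gref; have [X [XD Xfin]] := regular_family regD.
have /dependent_choice_ex[x xP] : forall i, exists x : power (M i) m,
    forall b, X b i -> g [fset b]%fset i -> psat phi x (r b i).
  move=> i; have /finite_fsetP[d dE] :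
      finite_set [set b | X b i /\ g [fset b]%fset i].
    by apply: sub_finite_set (Xfin i) => b [].
  have dP b : (b \in d) <-> X b i /\ g [fset b]%fset i.
    by have /(congr1 (@^~ b))/= -> := dE.
  have [d0|dN] := eqVneq d fset0.
    have [x _] := power_inh (M i) m; exists x => b Xb gb.
    by have /dP : X b i /\ g [fset b]%fset i by []; rewrite d0.
  have /gf[x xP] : g d i.
    by apply: (multiplicative_fset1 gref) => // b /dP[].
  by exists x => b Xb gb; apply: xP; apply/dP.
exists (fun k => uclass D (x ^~ k)) => b; apply/realized_uclass => //.
by apply: filterS2 (XD b) (gD [fset b]%fset) => i Xb gb; exact: xP.
Qed.

Hypothesis A_phi_set : forall i, phi_set (A i).

(** All of [L] is labelled because the type to be built needs parameters in [A i] for every index;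
    those outside [Lam] get the default [y]. *)
Lemma realize_finite_graph (f : {fset L} -> set L) (Lam : {fset L}) (i : L) :
  (forall H, minimal_excluded (isoSh phi (A i0)) H -> respects (B H) f) ->
  exists theta : L -> power (M i) n,
    [/\ forall b, A i (theta b),
        {in Lam, forall b, compatible phi (theta b) (theta b)} &
        {in Lam &, forall b c, b != c ->
           (f [fset b; c]%fset i <-> compatible phi (theta b) (theta c))}].
Proof.
move=> fresp; have [y Ay] := A_phi_set i.
(* An [fgraph] has a vertex, so an empty [Lam] induces none. *)
have [->|[b0 b0L]] := fset_0Vmem Lam; first by exists (fun=> y).
have k_gt0 : (0 < #|` Lam|)%N by rewrite cardfs_gt0; apply/fset0Pn; exists b0.
pose t (j : 'I_#|` Lam|) : L := nth b0 (enum_fset Lam) j.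
have tI : injective t.
  move=> j l /eqP; rewrite /t nth_uniq ?fset_uniq //; by move=> /eqP/val_inj.
have tS b : b \in Lam -> exists j, t j = b.
  by move=> /(nthP b0)[j jk jb]; exists (Ordinal jk).
pose P b c := f [fset b; c]%fset i.
have P_sym b c : P b c -> P c b by rewrite /P fsetUC.
have SG : isoSh phi (A i) (isotype_of (induced_graph k_gt0 P_sym t)).
  apply: (@isoSh_induced _ _ _ _ _ _ B) => // H; rewrite (A_isoSh i i0).
    exact: B_necessary.
  move=> mH x xI xadj.
  have [|e eB fe] := fresp H mH x xI i.
    move=> e /= /edgesP[v [w [vw ->]]]; rewrite imfset_set2; exact: xadj.
  have [_ /fintype.subsetP/(_ _ eB) + _] := B_necessary mH.
  rewrite !inE => /andP[_ /cards2P[v [w [_ E]]]]; exists v, w.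
  by rewrite -E; split=> //; rewrite /P -imfset_set2 -E.
have [th [thA th1 th2]] := isoSh_Sh SG.
have /choice[theta thetaP] : forall b, exists z,
    A i z /\ forall j, t j = b -> z = th j.
  move=> b; have [[j jb]|nj] := pselect (exists j, t j = b).
    by exists (th j); split=> // l; rewrite -jb => /tI->.
  by exists y; split=> // j jb; case: nj; exists j.
have thetaE j : theta (t j) = th j by have [_ /(_ j erefl)] := thetaP (t j).
exists theta; split=> [b|b /tS[j <-]|b c /tS[j <-] /tS[l <-] jl].
- by have [] := thetaP b.
- by rewrite thetaE; have [x xj] := th1 j; exists x.
have njl : j <> l by move=> E; rewrite E eqxx in jl.
rewrite !thetaE; split=> [fjl|/(th2 _ _ njl)/induced_adjP[] //].
by apply/(th2 _ _ njl)/induced_adjP.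
Qed.

Lemma refinement_of_realized (f : {fset L} -> set L) :
  (forall a : L -> power (ultraproduct D M) n,
    is_type phi a -> has_representatives_in A a -> realized phi a) ->
  maps_into D f -> graph_like_fun f ->
  (forall H, minimal_excluded (isoSh phi (A i0)) H -> respects (B H) f) ->
  exists g : {fset L} -> set L, multiplicative_refinement D f g.
Proof.
move=> real fD fgl fresp; have [X [XD Xfin]] := regular_family regD.
have /dependent_choice_ex[th thP] i : exists theta : L -> power (M i) n,
    [/\ forall b, A i (theta b),
        forall b, X b i -> compatible phi (theta b) (theta b) &
        forall b c, X b i -> X c i -> b != c ->
          (f [fset b; c]%fset i <-> compatible phi (theta b) (theta c))].
  have /finite_fsetP[d dE] := Xfin i.
  have dP b : X b i -> b \in d by have /(congr1 (@^~ b))/= -> := dE.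
  have [theta [tA t1 t2]] := realize_finite_graph d i fresp.
  by exists theta; split=> // [b /dP/t1|b c /dP bd /dP cd]; last exact: t2.
pose r b i := th i b.
have ta : is_type phi (fun b k => uclass D (r b ^~ k)).
  apply/is_type_uclass => // d.
  have XdD : D (\bigcap_(b in [set` d]) X b) by apply: filter_bigI => b _.
  (* When [i] lies in every [X b] with [b] in [d], compatibility of the labels agrees with [f] on
     pairs from [d], and [f d] forces all these pairs. *)
  apply: filterS2 XdD (fD d) => i Xd fd.
  have [tA t1 t2] := thP i.
  apply: (graph_like_satisfiable (r := r^~ i) (@A_graph_like i)) => [b _|b c bd cd];
    first exact: tA.
  have [->|bc] := eqVneq b c; first by apply: t1; exact: Xd.
  apply/t2 => //; try exact: Xd.
  suff d2 : (2 <= #|` d|)%N by apply: (graph_like_funP _ fgl d2).1.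
  have /fsubset_leq_card : ([fset b; c] `<=` d)%fset.
    by apply/fsubsetP => z /fset2P[]->.
  by rewrite cardfs2 bc.
have [|x xP] := real _ ta.
  by exists r; split=> // b i; have [tA _ _] := thP i; exact: tA.
have [y xy] := power_uclass x; rewrite {}xy in xP.
(* [X b] makes the labels faithful at [i], so that common solutions give back [f] on pairs; [f
   [fset b]] settles singletons, which graph-likeness does not govern. *)
pose Y b := [set i | [/\ X b i, f [fset b]%fset i & psat phi (y i) (r b i)]].
have YD b : D (Y b).
  have yb : D [set i | psat phi (y i) (r b i)] by apply/realized_uclass.
  by apply: filterS3 (XD b) (fD [fset b]%fset) yb => i.
(* The empty intersection is everything, so the factor [f fset0] keeps the value at [fset0] inside
   [f fset0]. *)
exists (fun d => f fset0 `&` \bigcap_(b in [set` d]) Y b); split.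
- by move=> d; apply: filterI; [exact: fD|apply: filter_bigI => b _].
- move=> d i [f0 Yd].
  have [d2|] := leqP 2 #|` d|.
    apply/graph_like_funP => // b c bd cd bc.
    have [Xb _ yb] := Yd b bd; have [Xc _ yc] := Yd c cd.
    by have [_ _ t2] := thP i; apply/t2 => //; exists (y i).
  rewrite ltnS leq_eqVlt ltnS leqn0 cardfs_eq0 => /orP[/cardfs1P[b E]|/eqP-> //].
  rewrite {}E in Yd *; by have [] := Yd b (fset11 b).
- move=> d e; rewrite setIACA setIid; congr setI; rewrite -bigcap_setU.
  by apply: eq_bigcapl; split=> z /=; rewrite inE => /orP.
Qed.

End Realization.

Theorem theorem7p16 (L : choiceType) (infL : infinite_set [set: L])
    (D : set_system L) (ultraD : UltraFilter D) (regD : regular_system D)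
    (S : language) (m n : nat) (phi : pformula S m n)
    (M : L -> structure S) (A : forall i : L, set (power (M i) n))
    (A_phi_set : forall i, phi_set (A i))
    (A_graph_like : forall i, graph_like_set phi (A i))
    (A_isoSh : forall i j, isoSh phi (A i) = isoSh phi (A j))
    (i0 : L)
    (B : forall H : isotype, {set {set (vertex (repr H))}})
    (B_necessary : forall H, minimal_excluded (isoSh phi (A i0)) H ->
       necessary (isoSh phi (A i0)) (B H)) :
  (forall a : L -> power (ultraproduct D M) n,
     is_type phi a -> has_representatives_in A a -> realized phi a)
  <->
  (forall f : {fset L} -> set L,
     maps_into D f -> graph_like_fun f ->
     (forall H, minimal_excluded (isoSh phi (A i0)) H -> respects (B H) f) ->
     exists g : {fset L} -> set L, multiplicative_refinement D f g).
Proof.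
split=> [real f|].
  exact: (refinement_of_realized ultraD regD A_graph_like A_isoSh B_necessary).
exact: (realized_of_refinements ultraD regD A_graph_like A_isoSh B_necessary).
Qed.
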